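(* Let $N\ge 2$, $0\le q<2$ and $p\ge 0$ be such that $p+q-1>0$, and assume that one of the following holds: (i) $1\le p<\frac{N+3}{N-1}$ and $p+q-1<\frac{4}{N-1}$; (ii) $0\le p<1$ and $p+q-1<\frac{(p+1)^2}{p(N-1)}$. Then every positive solution $u$ of $$-\Delta u=u^p|\nabla u|^q\quad\text{in }\mathbb{R}^N$$ is constant.
   Context: Solutions are classical, i.e. of class $C^2$. When $p=0$ the right-hand side $\frac{(p+1)^2}{p(N-1)}$ in (ii) is understood as $+\infty$. *)

(* Defs.v *)
From HB Require Import structures.
From mathcomp Require Import all_boot all_order all_algebra.
From mathcomp Require Import all_classical all_reals all_analysis.

Set Implicit Arguments.
Unset Strict Implicit.
Unset Printing Implicit Defensive.

Import Order.TTheory GRing.Theory Num.Theory.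
Import numFieldNormedType.Exports.

Local Open Scope classical_set_scope.
Local Open Scope ring_scope.

Section Euclidean.
Context {R : realType} {N : nat}.
Implicit Types u : 'rV[R]_N -> R.

Definition basis_vec (i : 'I_N) : 'rV[R]_N := delta_mx ord0 i.

Definition partial (i : 'I_N) u : 'rV[R]_N -> R := 'D_(basis_vec i) u.

Definition gradient u (x : 'rV[R]_N) : 'rV[R]_N := \row_i partial i u x.

(* The norm `|v| that the library puts on 'rV[R]_N is the sup norm. It induces
   the same topology, but |∇u| refers to the Euclidean norm. *)
Definition euclidean_norm (v : 'rV[R]_N) : R :=
  Num.sqrt (\sum_(i < N) v ord0 i ^+ 2).

Definition laplacian u (x : 'rV[R]_N) : R :=
  \sum_(i < N) partial i (partial i u) x.

(* 'D_v u x is a total operator with an unspecified value where the directional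
   derivative does not exist, so existence is required separately. *)
Definition class_C1 u : Prop :=
  continuous u /\
  forall i, (forall x, derivable u x (basis_vec i)) /\
            continuous (partial i u).

Definition class_C2 u : Prop :=
  class_C1 u /\ forall i, class_C1 (partial i u).

(* -Δu = u^p |∇u|^q on the whole space. The library's power satisfies
   0 `^ 0 = 1 and 0 `^ q = 0 for q != 0, so for q = 0 the right-hand side
   is u^p. *)
Definition positive_solution (p q : R) u : Prop :=
  [/\ class_C2 u,
      forall x, 0 < u x &
      forall x, - laplacian u x
                = u x `^ p * euclidean_norm (gradient u x) `^ q].

End Euclidean.

(* (p+1)^2 / (p (N-1)), read as +oo for p = 0. *)
Definition bound_small_p {R : realType} (N : nat) (p : R) : \bar R :=
  if p == 0 then +oo%E else ((p + 1) ^+ 2 / (p * (N%:R - 1)))%:E.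

(* Main.v *)
Require Import Defs.
From mathcomp Require Import all_boot all_order all_algebra.
From mathcomp Require Import all_classical all_reals all_analysis.
From mathcomp Require Import ring lra.
Import Order.TTheory GRing.Theory Num.Theory.
Import numFieldNormedType.Exports.
Set Implicit Arguments.
Unset Strict Implicit.
Unset Printing Implicit Defensive.
Local Open Scope classical_set_scope.
Local Open Scope ring_scope.

(** Bernstein's method. Write n = N - 1, z = |grad u|^2, f = u^p |grad u|^q, so
    that - Lap u = f, and consider L = m ln (r - |x - c|^2) + ln z - g ln u on the
    ball |x - c|^2 < r, the logarithm of |grad u|^2 u^(-g) times a cut-off. If
    grad u does not vanish at c, then L has a maximum at some x0 in the ball.

    Up to terms coming from the cut-off, grad L = 0 at x0 says that grad u is an
    eigenvector of the Hessian D^2 u with eigenvalue l = g z / (2 u), whence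
    |D^2 u|^2 >= l^2 + (Lap u - l)^2 / n ([hessian_trace_ineq]). Put this into
    Lap L <= 0, where Lap z is given by Bochner's identity. With A = f u / z the
    outcome is that a quadratic polynomial in A ([bernstein_form]) is bounded by
    cut-off terms. The hypotheses on p and q allow a choice of g in (0, 2] for
    which this polynomial is at least cc (1 + A^2) for A >= 0
    ([exists_coercive_exponent]); the cut-off terms are then absorbed
    ([bernstein_absorption]), and at x0
      z <= C k u^2  and  f^2 <= C k z,  where k = r / (r - |x0 - c|^2)^2
    and C does not depend on r, c or x0 ([estimate_at_max]). The logarithms of
    these bounds are affine in ln u and ln z, and a combination of them with
    nonnegative weights bounds ln z - g ln u ([log_interpolation]). As
    L(c) <= L(x0), this gives for large m a bound on ln z - g ln u at c that tends to
    -oo as r grows, so grad u vanishes at every c ([gradsq_eq0]).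

    Bochner's identity involves third derivatives of u, which need not exist a
    priori. They are avoided as follows. The difference quotients W_i of u along
    the axes are C^2, and sum_i W_i^2 converges to z. Its Laplacian is
    2 sum_i (|grad W_i|^2 + W_i Lap W_i), where Lap W_i is the difference quotient of
    Lap u = - f. As f is C^1 where grad u <> 0, this Laplacian converges too, to the
    value that Bochner's identity predicts. A maximum principle for such limits
    ([limit_max_principle]) replaces Lap L <= 0. *)

(** * Directional derivatives *)

Section Lines.
Context {R : realType} {V : normedModType R}.
Implicit Types (g : V -> R) (x v : V).

(** The theory of functions of one real variable applies along the line
    s |-> s *: v + x, on which a derivative along v is an ordinary one. *)
Lemma is_derive_line g x v (t d : R) :
  is_derive (t *: v + x) v g d -> is_derive t (1 : R) (fun s => g (s *: v + x)) d.
Proof.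
have E : (fun h : R => h^-1 *: ((g \o shift (t *: v + x)) (h *: v) - g (t *: v + x))) =
  (fun h : R => h^-1 *: (((fun s => g (s *: v + x)) \o shift t) (h *: (1 : R))
                         - g (t *: v + x))).
  by apply/funext => h /=; rewrite [h *: 1]mulr1 scalerDl addrA.
move=> [dg <-]; apply: DeriveDef; first by rewrite /derivable -E.
by rewrite /derive -E.
Qed.

Lemma is_derive_of_line g x v (d : R) :
  is_derive (0 : R) (1 : R) (fun s => g (s *: v + x)) d -> is_derive x v g d.
Proof.
have E : (fun h : R => h^-1 *: ((g \o shift x) (h *: v) - g x)) =
  (fun h : R => h^-1 *: (((fun s => g (s *: v + x)) \o shift 0) (h *: (1 : R))
                         - g (0 *: v + x))).
  by apply/funext => h /=; rewrite [h *: 1]mulr1 addr0 scale0r add0r.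
move=> [dg <-]; apply: DeriveDef; first by rewrite /derivable E.
by rewrite /derive E.
Qed.

Lemma is_derive_line0 g x v (d : R) :
  is_derive x v g d -> is_derive (0 : R) (1 : R) (fun s => g (s *: v + x)) d.
Proof. by move=> dg; apply: is_derive_line; rewrite scale0r add0r. Qed.

Lemma is_derive_comp1 (F : R -> R) g x v (d d' : R) :
  is_derive x v g d -> is_derive (g x) (1 : R) F d' ->
  is_derive x v (fun y => F (g y)) (d' * d).
Proof.
move=> /is_derive_line0 dg dF; apply: is_derive_of_line.
by apply: (@is_derive1_comp _ F _ _ _ _ _ dg); rewrite scale0r add0r.
Qed.

Lemma is_derive_ln g x v (d : R) : 0 < g x ->
  is_derive x v g d -> is_derive x v (fun y => ln (g y)) (d / g x).
Proof.
move=> g0 dg; rewrite mulrC; apply: is_derive_comp1 => //.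
exact: is_derive1_ln.
Qed.

Lemma is_derive_ln_derive g g1 x v (d : R) : 0 < g x ->
  is_derive x v g (g1 x) -> is_derive x v g1 d ->
  is_derive x v (fun y => g1 y / g y) (d / g x - (g1 x / g x) ^+ 2).
Proof.
move=> g0 dg dg1.
have gn0 : g x != 0 by rewrite gt_eqF.
have dV : is_derive x v (fun y => (g y)^-1) (- (g x) ^- 2 * g1 x).
  by apply: DeriveDef; [apply: derivableV; [|exact: ex_derive]|rewrite deriveV ?derive_val].
apply: (is_derive_eq (is_deriveM dg1 dV)).
rewrite /= /GRing.scale /=; field.
by [].
Qed.

Lemma is_derive_sumE (I : finType) (h : I -> V -> R) x v (dh : I -> R) :
  (forall k, is_derive x v (h k) (dh k)) ->
  is_derive x v (fun y => \sum_k h k y) (\sum_k dh k).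
Proof.
move=> dhi; have -> : (fun y => \sum_k h k y) = \sum_k h k.
  by apply/funext => y; rewrite fct_sumE.
elim/big_ind2 : _ => // [|f df g dg]; first exact: is_derive_cst.
exact: is_deriveD.
Qed.

Lemma near_line (P : V -> Prop) x v :
  (\forall y \near x, P y) -> \forall t \near (0 : R), P (t *: v + x).
Proof.
move=> nP.
have C : (fun t : R => t *: v + x) @ 0 --> x.
  rewrite -[X in _ --> X]add0r -(scale0r v).
  by apply: cvgD; [apply: cvgZr_tmp; exact: cvg_id|exact: cvg_cst].
exact: C nP.
Qed.

Arguments near_line {P x} v _.

Lemma near_interval (P : R -> Prop) : (\forall t \near (0 : R), P t) ->
  exists2 e : R, 0 < e & forall t, `|t| < e -> P t.
Proof.
move=> [e /= e0 eP]; exists e => // t te; apply: eP => /=.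
by rewrite sub0r normrN.
Qed.

Lemma near_small_scale v (e : R) : 0 < e ->
  \forall t \near (0 : R)^', t != 0 /\ forall s : R, `|s| <= `|t| -> `|s *: v| < e.
Proof.
move=> e0; have v0 : 0 < `|v| + 1 by rewrite ltr_wpDl.
have d0 : 0 < e / (`|v| + 1) by rewrite divr_gt0.
exists (e / (`|v| + 1)) => //= t; rewrite /= sub0r normrN => td tn0; split => // s st.
rewrite normrZ; apply: (@le_lt_trans _ _ (`|t| * (`|v| + 1))).
  by rewrite ler_pM // lerDl.
by rewrite -ltr_pdivlMr.
Qed.

Definition diffq g v h y : R := h^-1 * (g (h *: v + y) - g y).

Lemma is_derive_diffq_cvg g x v (d : R) :
  is_derive x v g d -> diffq g v h x @[h --> (0 : R)^'] --> d.
Proof. by move=> [dg <-]; exact: dg. Qed.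

Lemma derive0_at_local_max g g1 x v :
  (\forall y \near x, is_derive y v g (g1 y)) ->
  (\forall y \near x, g y <= g x) -> g1 x = 0.
Proof.
move=> dg gle.
have [e e0 P] := near_interval (near_line v (filterI dg gle)).
pose f := fun s : R => g (s *: v + x).
have H (t : R) : t \in `](- e), e[%R -> `|t| < e.
  by rewrite in_itv /= ltr_norml.
have df (t : R) : t \in `](- e), e[%R -> is_derive t (1 : R) f (g1 (t *: v + x)).
  by move=> /H/P[? _]; exact: is_derive_line.
have mx (t : R) : t \in `](- e), e[%R -> f t <= f 0.
  by move=> /H/P[_]; rewrite /f scale0r add0r.
have i0 : (0 : R) \in `](- e), e[%R by rewrite in_itv /= oppr_lt0 e0.
have [_ ] : is_derive (0 : R) (1 : R) f 0.
  apply: (derive1_at_max _ _ i0 mx); first by rewrite ge0_cp // ltW.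
  by move=> t /df [].
by have [_ ->] := df _ i0; rewrite scale0r add0r.
Qed.

(** If d > 0, then g1 is positive just after x on the line through x along v, and
    the mean value theorem makes g increase there. *)
Lemma derive2_le0_at_local_max g g1 x v (d : R) :
  (\forall y \near x, is_derive y v g (g1 y)) -> is_derive x v g1 d ->
  (\forall y \near x, g y <= g x) -> d <= 0.
Proof.
move=> dg dg1 gle; have g10 := derive0_at_local_max dg gle.
rewrite leNgt; apply/negP => d0.
have pos : \forall t \near (0 : R), t != 0 -> 0 < t^-1 * g1 (t *: v + x).
  have H : \forall t \near (0 : R), t != 0 -> 0 < diffq g1 v t x.
    exact: cvgr_gt (is_derive_diffq_cvg dg1) _ d0.
  by apply: filterS H => t /[apply]; rewrite /diffq g10 subr0.
have [e e0 P] := near_interval (filterI (near_line v (filterI dg gle)) pos).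
pose f := fun s : R => g (s *: v + x).
pose t := e / 2.
have t0 : 0 < t by rewrite divr_gt0.
have te : t < e by rewrite /t ltr_pdivrMr // ltr_pMr // ltr1n.
have lt_e s : 0 <= s -> s <= t -> `|s| < e.
  by move=> s0 st; rewrite ger0_norm // (le_lt_trans st).
have df (s : R) : 0 <= s -> s <= t -> is_derive s (1 : R) f (g1 (s *: v + x)).
  by move=> s0 st; have [[D _] _] := P _ (lt_e _ s0 st); exact: is_derive_line D.
have [||c] := @MVT R f (fun s => g1 (s *: v + x)) 0 t t0.
- by move=> s; rewrite in_itv /= => /andP[/ltW ? /ltW ?]; exact: df.
- apply: derivable_within_continuous => s; rewrite in_itv /= => /andP[? ?].
  by have [] := df s.
rewrite in_itv /= => /andP[c0 ct]; rewrite subr0 => E.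
have [[_ _]] := P _ (lt_e _ (ltW c0) (ltW ct)).
rewrite gt_eqF // pmulr_rgt0 ?invr_gt0 // => /(_ isT) gc.
have [[_ + _]] := P _ (lt_e _ (ltW t0) (lexx _)).
have : 0 < f t - f 0 by rewrite E mulr_gt0.
by rewrite subr_gt0 /f scale0r add0r ltNge => /negP.
Qed.

End Lines.

(** * Limits of real functions along a filter *)

Section FilterLimits.
Context {R : realType} {T : Type} (F : set_system T) {FF : Filter F}.

Lemma cvg_sumr (I : finType) (h : I -> T -> R) (l : I -> R) :
  (forall k, h k @ F --> l k) -> (fun t => \sum_k h k t) @ F --> \sum_k l k.
Proof.
move=> hl; elim: (index_enum I) => [|k r IH].
  by under eq_cvg do rewrite big_nil; rewrite big_nil; exact: cvg_cst.
by under eq_cvg do rewrite big_cons; rewrite big_cons; exact: cvgD.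
Qed.

Lemma cvg_div (f g : T -> R) (a b : R) : b != 0 ->
  f @ F --> a -> g @ F --> b -> (fun t => f t / g t) @ F --> a / b.
Proof. by move=> b0 fa gb; exact: cvgM fa (cvgV b0 gb). Qed.

Lemma cvg_sqr (f : T -> R) (a : R) : f @ F --> a -> (fun t => f t ^+ 2) @ F --> a ^+ 2.
Proof. by move=> fa; exact: (cvgM fa fa). Qed.

Lemma cvg_ln (f : T -> R) (a : R) :
  0 < a -> f @ F --> a -> (fun t => ln (f t)) @ F --> ln a.
Proof. by move=> a0 fa; apply: (cvg_comp f (@ln R)); [exact: fa|exact: continuous_ln]. Qed.

Lemma cvg_log_combination (m g : R) (ph zh uh : T -> R) (ph0 z u : R) :
  0 < ph0 -> 0 < z -> 0 < u ->
  ph @ F --> ph0 -> zh @ F --> z -> uh @ F --> u ->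
  (fun t => m * ln (ph t) + ln (zh t) - g * ln (uh t)) @ F -->
  m * ln ph0 + ln z - g * ln u.
Proof.
move=> ph_gt0 z_gt0 u_gt0 phC zC uC.
apply: cvgB; first apply: cvgD; last by apply: cvgMl_tmp; exact: cvg_ln.
  by apply: cvgMl_tmp; exact: cvg_ln.
exact: cvg_ln.
Qed.

Lemma cvg_sum_log_second_derivative (J : finType) (m g : R)
    (ph zh uh : T -> R) (p1 z1 z2 u1 u2 : J -> T -> R)
    (ph0 z u Z2 : R) (p1' z1' u1' u2' : J -> R) :
  0 < ph0 -> 0 < z -> 0 < u ->
  ph @ F --> ph0 -> zh @ F --> z -> uh @ F --> u ->
  (forall j, p1 j @ F --> p1' j) -> (forall j, z1 j @ F --> z1' j) ->
  (forall j, u1 j @ F --> u1' j) -> (forall j, u2 j @ F --> u2' j) ->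
  (fun t => \sum_j z2 j t) @ F --> Z2 ->
  (fun t => \sum_j (m * (- 2 / ph t - (p1 j t / ph t) ^+ 2)
                    + (z2 j t / zh t - (z1 j t / zh t) ^+ 2)
                    - g * (u2 j t / uh t - (u1 j t / uh t) ^+ 2))) @ F -->
  m * (\sum_j (- 2 / ph0 - (p1' j / ph0) ^+ 2))
  + (Z2 / z - \sum_j (z1' j / z) ^+ 2)
  - g * (\sum_j (u2' j / u - (u1' j / u) ^+ 2)).
Proof.
move=> /lt0r_neq0 ph_neq0 /lt0r_neq0 z_neq0 /lt0r_neq0 u_neq0 phC zC uC p1C z1C u1C u2C z2C.
under eq_cvg => t.
  rewrite !(sumrB, big_split) /= -!mulr_sumr -mulr_suml !(sumrB, big_split) /=.
  over.
rewrite !sumrB.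
apply: cvgB; first apply: cvgD.
- apply: cvgMl_tmp; apply: cvgB; apply: cvg_sumr => j.
    by apply: cvg_div => //; exact: cvg_cst.
  by apply: cvg_sqr; exact: cvg_div.
- apply: cvgB; first exact: cvg_div.
  by apply: cvg_sumr => j; apply: cvg_sqr; exact: cvg_div.
- apply: cvgMl_tmp; apply: cvgB; apply: cvg_sumr => j; first exact: cvg_div.
  by apply: cvg_sqr; exact: cvg_div.
Qed.

End FilterLimits.

(** * Coordinates and Euclidean balls *)

Section Coordinates.
Context {R : realType} {N : nat}.
Implicit Types (x y c v : 'rV[R]_N) (i j : 'I_N).

Lemma is_derive_coord y v j : is_derive y v (fun x => x ord0 j) (v ord0 j).
Proof.
apply: is_derive_of_line.
have -> : (fun s : R => (s *: v + y) ord0 j) = (fun s : R => v ord0 j *: s) + cst (y ord0 j).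
  by apply/funext => s; rewrite !mxE mulrC.
apply: is_derive_eq; by rewrite addr0 [LHS]mulr1.
Qed.

Lemma basis_vecE i j : (basis_vec i : 'rV[R]_N) ord0 j = (j == i)%:R.
Proof. by rewrite mxE eqxx eq_sym. Qed.

Definition sqdist c x : R := \sum_j (x ord0 j - c ord0 j) ^+ 2.

Lemma sqdist_xx c : sqdist c c = 0.
Proof. by rewrite /sqdist big1 // => j _; rewrite subrr expr0n. Qed.

Lemma sqdist_coord c x j : (x ord0 j - c ord0 j) ^+ 2 <= sqdist c x.
Proof.
rewrite /sqdist (bigD1 j) //= lerDl; apply: sumr_ge0 => k _; exact: sqr_ge0.
Qed.

Lemma sqdist_ge0 c x : 0 <= sqdist c x.
Proof. by apply: sumr_ge0 => j _; exact: sqr_ge0. Qed.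

Lemma continuous_sqdist c : continuous (sqdist c).
Proof.
move=> x; apply: (@cvg_sumr _ _ (nbhs x) _) => j.
apply: (cvg_comp _ (fun t : R => t ^+ 2)); last exact: exprn_continuous.
by apply: cvgB; [exact: coord_continuous|exact: cvg_cst].
Qed.

Lemma is_derive_coordB c y i j :
  is_derive y (basis_vec i) (fun x => x ord0 j - c ord0 j) (j == i)%:R.
Proof.
have := is_derive_coord y (basis_vec i) j; rewrite basis_vecE => D.
have := is_deriveB D (is_derive_cst (c ord0 j) y (basis_vec i)).
by rewrite subr0.
Qed.

Lemma is_derive_sqdist c y i :
  is_derive y (basis_vec i) (sqdist c) (2 * (y ord0 i - c ord0 i)).
Proof.
have -> : 2 * (y ord0 i - c ord0 i) = \sum_j (2 * (y ord0 j - c ord0 j) * (j == i)%:R).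
  by rewrite (bigD1 i) //= eqxx mulr1 big1 ?addr0 // => j /negPf ->; rewrite mulr0.
apply: is_derive_sumE => j.
have := is_deriveX 2 (is_derive_coordB c y i j).
by rewrite /= expr1.
Qed.

Lemma compact_sqdist c (r : R) (A : set R) :
  closed A -> A `<=` [set t | t <= r] -> compact (sqdist c @^-1` A).
Proof.
move=> cA Ar.
pose B := [set x : 'rV[R]_N |
  forall j, `[c ord0 j - (r + 1), c ord0 j + (r + 1)]%classic (x ord0 j)].
have cB : compact B.
  apply: (@rV_compact R N (fun j => `[c ord0 j - (r + 1), c ord0 j + (r + 1)]%classic)) => j.
  exact: segment_compact.
apply: (subclosed_compact _ cB).
  by apply: closed_comp => // x _; exact: continuous_sqdist.
move=> x /= /Ar /= xr j /=.
rewrite in_itv /= -ler_distl.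
have := le_trans (sqdist_coord c x j) xr.
rewrite -[_ ^+ 2]real_normK ?num_real // => H.
have := normr_ge0 (x ord0 j - c ord0 j); move: (`| _ |) H => a H a0.
nra.
Qed.

Lemma nbhs_sqdist x (U : set 'rV[R]_N) : nbhs x U ->
  exists2 r : R, 0 < r & forall y, sqdist x y <= r -> U y.
Proof.
move=> /nbhs_ballP[e /= e0 eU]; exists ((e / 2) ^+ 2); first by rewrite exprn_gt0 ?divr_gt0.
move=> y yr; apply: eU; split => // i j.
rewrite ord1 -ball_normE /= distrC.
have := le_trans (sqdist_coord x y j) yr.
rewrite -[X in X <= _]real_normK ?num_real // ler_pXn2r ?nnegrE ?divr_ge0
  ?(ltW e0) // => /le_lt_trans; apply.
by rewrite ltr_pdivrMr // ltr_pMr // ltr1n.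
Qed.

Lemma exists_ball_max (psi : 'rV[R]_N -> R) c (r : R) :
  0 < r -> (forall y, sqdist c y <= r -> {for y, continuous psi}) ->
  exists2 x, sqdist c x <= r & forall y, sqdist c y <= r -> psi y <= psi x.
Proof.
move=> r0 cpsi.
have cB : compact (sqdist c @^-1` [set t | t <= r]).
  by apply: (@compact_sqdist _ r); [exact: closed_le|move=> t].
have [||x] := compact_EVT_max _ cB (_ : {within _, continuous psi}).
- by exists c; rewrite /= sqdist_xx ltW.
- by apply: continuous_in_subspaceT => y; rewrite inE; exact: cpsi.
rewrite inE => xr max; exists x => // y yr; apply: max.
by rewrite inE.
Qed.

End Coordinates.

(** * Difference quotients *)

Section DifferenceQuotient.
Context {R : realType} {V : normedModType R}.
Implicit Types (g : V -> R) (x y v w : V) (h : R).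

Lemma diffq_mvt g g1 v y h : h != 0 ->
  (forall s : R, `|s| <= `|h| -> is_derive (s *: v + y) v g (g1 (s *: v + y))) ->
  exists2 s : R, `|s| <= `|h| & diffq g v h y = g1 (s *: v + y).
Proof.
move=> h0 dg.
pose f := fun s : R => g (s *: v + y).
have df (s : R) : `|s| <= `|h| -> is_derive s (1 : R) f (g1 (s *: v + y)).
  by move=> /dg ?; exact: is_derive_line.
have cf a b : (forall s, s \in `[a, b]%R -> `|s| <= `|h|) -> {within `[a, b], continuous f}.
  by move=> H; apply: derivable_within_continuous => s /H /df [].
have dfo a b : (forall s, s \in `[a, b]%R -> `|s| <= `|h|) ->
    forall s, s \in `]a, b[%R -> is_derive s (1 : R) f (g1 (s *: v + y)).
  by move=> H s /subset_itv_oo_cc /H /df.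
have f0 : f 0 = g y by rewrite /f scale0r add0r.
have [hp|hn] : h > 0 \/ h < 0 by apply/orP; rewrite -neq_lt eq_sym.
  have H s : s \in `[0, h]%R -> `|s| <= `|h|.
    by rewrite in_itv /= => /andP[s0 sh]; rewrite !ger0_norm // ltW.
  have [s] := MVT hp (dfo _ _ H) (cf _ _ H).
  move=> /subset_itv_oo_cc /H sh; rewrite subr0 => E; exists s => //.
  by rewrite /diffq -/(f h) -f0 E mulrC mulfK.
have H s : s \in `[h, 0]%R -> `|s| <= `|h|.
  by rewrite in_itv /= => /andP[hs s0]; rewrite !ler0_norm // ?lerN2 // ltW.
have [s] := MVT hn (dfo _ _ H) (cf _ _ H).
move=> /subset_itv_oo_cc /H sh; rewrite sub0r => E; exists s => //.
by rewrite /diffq -/(f h) -f0 -opprB E !mulrN opprK mulrC mulfK.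
Qed.

(** The base point y varies together with the step h: by the mean value theorem the
    quotient is a value of g1 at a point that tends to x. *)
Lemma diffq_cvg g g1 v x :
  (\forall y \near x, is_derive y v g (g1 y)) -> {for x, continuous g1} ->
  (fun yh : V * R => diffq g v yh.2 yh.1) @ filter_prod (nbhs x) (0 : R)^' --> g1 x.
Proof.
move=> dg cg1 A nA.
have /nbhs_ballP[e /= e0 eP] : nbhs x [set y | is_derive y v g (g1 y) /\ A (g1 y)].
  exact: filterI dg (cg1 A nA).
have e20 : 0 < e / 2 by rewrite divr_gt0.
exists (ball x (e / 2),
  [set h : R | h != 0 /\ forall s : R, `|s| <= `|h| -> `|s *: v| < e / 2]).
  by split; [exact: nbhsx_ballx|exact: near_small_scale].
move=> [y h] /= [yx [h0 hP]].
have P s : `|s| <= `|h| -> ball x e (s *: v + y).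
  move=> /hP sv; rewrite -ball_normE /= opprD addrA addrAC.
  apply: (le_lt_trans (ler_normB _ _)).
  by rewrite (splitr e) ltrD //; rewrite -ball_normE in yx.
have [s sh ->] := @diffq_mvt g g1 v y h h0 (fun s sh => (eP _ (P _ sh)).1).
exact: (eP _ (P _ sh)).2.
Qed.

(** Difference quotients of a C^2 function are therefore C^2, unlike its derivatives. *)
Lemma is_derive_diffq g g1 v w h y :
  (forall x, is_derive x w g (g1 x)) ->
  is_derive y w (diffq g v h) (diffq g1 v h y).
Proof.
move=> dg.
have D1 : is_derive y w (fun y => g (h *: v + y)) (g1 (h *: v + y)).
  apply: is_derive_of_line.
  have -> : (fun s : R => g (h *: v + (s *: w + y))) = fun s : R => g (s *: w + (h *: v + y)).
    by apply/funext => s; rewrite addrCA.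
  exact: is_derive_line0.
exact: (is_deriveZ h^-1 (is_deriveB D1 (dg y))).
Qed.

Lemma continuous_diffq g v h : continuous g -> continuous (diffq g v h).
Proof.
move=> cg y; apply: cvgMl_tmp; apply: cvgB; last exact: cg.
apply: (cvg_comp (fun y => h *: v + y)); last exact: cg.
by apply: cvgD; [exact: cvg_cst|exact: cvg_id].
Qed.

End DifferenceQuotient.

(** * A maximum principle for limits of smooth functions *)

(** If G > 0, subtract e |y - x0|^2 with e so small that the second derivatives of
    M h still have a positive sum near x0. On a small sphere around x0 the
    perturbed L stays below its value at x0. As M converges jointly in the point and
    in h, compactness of the sphere gives the same for the perturbed M h, which then
    has a maximum inside the ball, where its second derivatives are nonpositive. *)
Lemma limit_max_principle {R : realType} {N : nat} (I : Type) (F : set_system I)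
    {FF : ProperFilter F} (L : 'rV[R]_N -> R) (M : I -> 'rV[R]_N -> R)
    (M1 M2 : I -> 'I_N -> 'rV[R]_N -> R) x0 (G : R) :
  (\forall y \near x0, L y <= L x0) ->
  (\forall x \near x0, (fun yh => M yh.2 yh.1) @ filter_prod (nbhs x) F --> L x) ->
  (\forall yh \near filter_prod (nbhs x0) F, {for yh.1, continuous (M yh.2)} /\
     forall j, is_derive yh.1 (basis_vec j) (M yh.2) (M1 yh.2 j yh.1) /\
               is_derive yh.1 (basis_vec j) (M1 yh.2 j) (M2 yh.2 j yh.1)) ->
  (fun yh => \sum_j M2 yh.2 j yh.1) @ filter_prod (nbhs x0) F --> G ->
  G <= 0.
Proof.
move=> Lmax ML dM M2G; rewrite leNgt; apply/negP => G0.
(* the subtracted function e |y - x0|^2 has Laplacian 2 N e <= G / 2 *)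
pose e := G / (4 * N.+1%:R).
have e0 : 0 < e by rewrite divr_gt0 // mulr_gt0.
have eG : N%:R * (e * 2) <= G / 2.
  rewrite /e -(natr1 N); have : (0 : R) <= N%:R by []. move: (N%:R : R) => k k0.
  rewrite -subr_ge0 (_ : _ - _ = G / 2 / (k + 1)); last by field; lra.
  by rewrite !divr_ge0 // ?ltW //; lra.
have G2 : G / 2 < G by rewrite ltr_pdivrMr // ltr_pMr // ltr1n.
have [[U W] /= [nU FW] UW] := filterI dM (cvgr_gt G M2G _ G2).
have [r r0 rU] := nbhs_sqdist (filterI nU (filterI Lmax ML)).
pose K h y := M h y - e * sqdist x0 y.
have cK h y : W h -> sqdist x0 y <= r -> {for y, continuous (K h)}.
  move=> Wh /rU [Uy _]; have [[cM _] _] := UW (y, h) (conj Uy Wh).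
  have {}cM : M h @ y --> M h y by exact: cM.
  by apply: (cvgB cM); apply: cvgMl_tmp; exact: continuous_sqdist.
have er : 0 < e * r by rewrite mulr_gt0.
have Lr : L x0 - e * r / 2 < L x0 by lra.
have [[U' W'] /= [nU' FW'] UW'] := cvgr_gt (L x0) (nbhs_singleton ML) _ Lr.
have cS : compact (sqdist x0 @^-1` [set r]).
  by apply: compact_sqdist; [exact: closed_eq|move=> t -> /=].
(* on the sphere the perturbed limit is at most L x0 - e r *)
have FS : \forall h \near F,
    (sqdist x0 @^-1` [set r]) `<=` (fun y => K h y < L x0 - e * r / 2).
  apply: (proj1 (compact_near_coveringP _) cS I F (fun h y => K h y < L x0 - e * r / 2)) => x /= xr.
  have xr' : sqdist x0 x <= r by rewrite xr.
  have [_ [Lx Mx]] := rU x xr'.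
  have Kx : (fun yh => M yh.2 yh.1 - e * sqdist x0 yh.1) @ filter_prod (nbhs x) F -->
      L x - e * sqdist x0 x.
    apply: cvgB => //; apply: cvgMl_tmp.
    by apply: (cvg_comp (@fst _ I) (sqdist x0)); [exact: cvg_fst|exact: continuous_sqdist].
  apply: (cvgr_lt _ Kx); rewrite xr; lra.
have [h [[Wh W'h] Sh]] := filter_ex (filterI (filterI FW FW') FS).
have [y1 y1r ymax] := exists_ball_max r0 (fun y => @cK h y Wh).
(* on the sphere the values are below the one at x0 *)
have y1lt : sqdist x0 y1 < r.
  rewrite lt_neqAle y1r andbT; apply/eqP => /Sh.
  rewrite ltNge => /negP; apply.
  have := ymax x0; rewrite sqdist_xx => /(_ (ltW r0)); apply: le_trans.
  have := UW' (x0, h) (conj (nbhs_singleton nU') W'h).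
  by rewrite /= /K sqdist_xx mulr0 subr0 => /ltW.
have near_r : \forall y \near y1, sqdist x0 y < r.
  exact: cvgr_lt (@continuous_sqdist _ _ x0 y1) _ y1lt.
have Kle : \forall y \near y1, K h y <= K h y1.
  by apply: filterS near_r => y yr; apply: ymax; exact: ltW.
have dK j y : sqdist x0 y <= r ->
    is_derive y (basis_vec j) (K h) (M1 h j y - e * (2 * (y ord0 j - x0 ord0 j))).
  move=> /rU [Uy _]; have [[_ /(_ j)[D _]] _] := UW (y, h) (conj Uy Wh).
  exact: (is_deriveB D (is_deriveZ e (is_derive_sqdist x0 y j))).
have [Uy1 _] := rU _ y1r.
have [[_ D12] SM2] := UW (y1, h) (conj Uy1 Wh).
have M2le j : M2 h j y1 <= e * 2.
  rewrite -subr_le0.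
  apply: (@derive2_le0_at_local_max _ _ (K h) _ y1 (basis_vec j) _ _ _ Kle).
    by apply: filterS near_r => y /ltW; exact: dK.
  have D := is_deriveZ 2 (is_derive_coordB x0 y1 j j).
  have := is_deriveB (D12 j).2 (is_deriveZ e D).
  by rewrite eqxx /GRing.scale /= mulr1.
have : \sum_j M2 h j y1 <= N%:R * (e * 2).
  apply: (le_trans (ler_sum _ (fun j _ => M2le j))).
  by rewrite sumr_const card_ord [leRHS]mulr_natl.
move=> /le_trans /(_ eG); rewrite leNgt => /negP; apply; exact: SM2.
Qed.

(** * Algebraic inequalities *)

Lemma cauchy_schwarz_sum {R : realFieldType} (I : finType) (a b : I -> R) :
  (\sum_i a i * b i) ^+ 2 <= (\sum_i a i ^+ 2) * (\sum_i b i ^+ 2).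
Proof.
set A := \sum_i a i ^+ 2; set B := \sum_i b i ^+ 2; set S := \sum_i a i * b i.
have A0 : 0 <= A by apply: sumr_ge0 => i _; exact: sqr_ge0.
have H (t : R) : 0 <= A * t ^+ 2 - 2 * t * S + B.
  have -> : A * t ^+ 2 - 2 * t * S + B = \sum_i (a i * t - b i) ^+ 2.
    rewrite mulr_suml mulr_sumr -sumrB -big_split /=.
    by apply: eq_bigr => i _; ring.
  by apply: sumr_ge0 => i _; exact: sqr_ge0.
have [A0'|An0] := eqVneq A 0; last first.
  have Ap : 0 < A by rewrite lt_def An0.
  have := H (S / A).
  have -> : A * (S / A) ^+ 2 - 2 * (S / A) * S + B = (A * B - S ^+ 2) / A by field.
  by rewrite pmulr_lge0 ?invr_gt0 // subr_ge0.
have [->|S0] := eqVneq S 0; first by rewrite A0' mul0r expr0n.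
have := H ((B + 1) / (2 * S)).
have -> : A * ((B + 1) / (2 * S)) ^+ 2 - 2 * ((B + 1) / (2 * S)) * S + B = - 1.
  by rewrite A0'; field.
by rewrite oppr_ge0 ler10.
Qed.

(** Expand the squared distance of H to l P + b (1 - P), where P is the orthogonal
    projection onto the line of a and b = (t - l) / n. *)
Lemma hessian_trace_ineq {R : realFieldType} (N : nat) (n : R)
    (a : 'I_N -> R) (H : 'I_N -> 'I_N -> R) (z l t : R) :
  N%:R = n + 1 -> 0 < n -> z = \sum_i a i ^+ 2 -> 0 < z ->
  z * l = \sum_i \sum_j a i * H i j * a j -> t = \sum_i H i i ->
  l ^+ 2 + (t - l) ^+ 2 / n <= \sum_i \sum_j H i j ^+ 2.
Proof.
move=> Nn n0 zE z0 lE tE.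
have zn0 : z != 0 by rewrite gt_eqF.
pose b := (t - l) / n; pose al := l - b.
pose P i j := a i * a j / z; pose d (i j : 'I_N) : R := (i == j)%:R.
have sumd (h : 'I_N -> R) i : \sum_j h j * d i j = h i.
  rewrite (bigD1 i) //= /d eqxx mulr1 big1 ?addr0 // => j.
  by rewrite eq_sym => /negPf ->; rewrite mulr0.
have PP : \sum_i \sum_j P i j ^+ 2 = 1.
  transitivity (\sum_i a i ^+ 2 * z^-1).
    apply: eq_bigr => i _; transitivity (\sum_j a i ^+ 2 * z^-1 ^+ 2 * a j ^+ 2).
      by apply: eq_bigr => j _; rewrite /P; ring.
    by rewrite -mulr_sumr -zE; field.
  by rewrite -mulr_suml -zE mulfV.
have Pd : \sum_i \sum_j P i j * d i j = 1.
  under eq_bigr do rewrite sumd.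
  by rewrite /P -mulr_suml -(eq_bigr _ (fun i _ => expr2 (a i))) -zE mulfV.
have dd : \sum_i \sum_j d i j ^+ 2 = n + 1.
  transitivity (\sum_(i < N) (1 : R)).
    by apply: eq_bigr => i _; under eq_bigr do rewrite expr2; rewrite sumd /d eqxx.
  by rewrite sumr_const card_ord -Nn.
have HP : \sum_i \sum_j H i j * P i j = l.
  apply: (mulfI zn0); rewrite lE mulr_sumr; apply: eq_bigr => i _.
  by rewrite mulr_sumr; apply: eq_bigr => j _; rewrite /P; field.
have Hd : \sum_i \sum_j H i j * d i j = t.
  by rewrite tE; apply: eq_bigr => i _; rewrite sumd.
have : 0 <= \sum_i \sum_j (H i j - al * P i j - b * d i j) ^+ 2.
  by apply: sumr_ge0 => i _; apply: sumr_ge0 => j _; exact: sqr_ge0.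
have -> : \sum_i \sum_j (H i j - al * P i j - b * d i j) ^+ 2 =
   \sum_i \sum_j H i j ^+ 2 + al ^+ 2 * (\sum_i \sum_j P i j ^+ 2)
   + b ^+ 2 * (\sum_i \sum_j d i j ^+ 2) - 2 * al * (\sum_i \sum_j H i j * P i j)
   - 2 * b * (\sum_i \sum_j H i j * d i j) + 2 * al * b * (\sum_i \sum_j P i j * d i j).
  rewrite !mulr_sumr -!sumrN -!big_split /=; apply: eq_bigr => i _.
  rewrite !mulr_sumr -!sumrN -!big_split /=; apply: eq_bigr => j _; ring.
rewrite PP Pd dd HP Hd => ge0; rewrite -subr_ge0; apply: (le_trans ge0).
by rewrite le_eqVlt; apply/orP; left; apply/eqP; rewrite /al /b; field; rewrite gt_eqF.
Qed.

(** The polynomial is at least a (A - t)^2 + (B + 2 a t) A, which is positive for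
    A >= 0 and grows quadratically. *)
Lemma quadratic_coercive {R : realFieldType} (a B c0 t : R) :
  0 < a -> 0 < t -> 0 < B + 2 * a * t -> a * t ^+ 2 <= c0 ->
  exists2 c : R, 0 < c & forall A, 0 <= A -> c * (1 + A ^+ 2) <= a * A ^+ 2 + B * A + c0.
Proof.
move=> a0 t0 Bt c0t.
(* shrinking B + 2 a t to at most 2 a t keeps the discriminant below under control *)
have [e [e0 eB ea]] : exists e, [/\ 0 < e, e <= B + 2 * a * t & e <= 2 * a * t].
  have at0 : 0 < 2 * a * t by rewrite !mulr_gt0.
  have [H|H] := leP (B + 2 * a * t) (2 * a * t).
    by exists (B + 2 * a * t); split.
  by exists (2 * a * t); split => //; exact: ltW.
have t1 : 0 < 1 + t ^+ 2 by rewrite ltr_wpDr ?sqr_ge0.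
pose c := t * e / (2 * (1 + t ^+ 2)).
have cE : c * (1 + t ^+ 2) = t * e / 2 by rewrite /c; field; rewrite gt_eqF.
have cp : 0 < c by rewrite divr_gt0 ?mulr_gt0.
have ca : c < a.
  have : t * e <= t * (2 * a * t) by rewrite ler_pM2l.
  move=> H; have : c * (1 + t ^+ 2) < a * (1 + t ^+ 2) by rewrite cE; nra.
  by rewrite ltr_pM2r.
exists c => // A A0.
rewrite -subr_ge0.
apply: (@le_trans _ _ ((a - c) * A ^+ 2 - (2 * a * t - e) * A + (a * t ^+ 2 - c))).
  have ac : 0 < a - c by rewrite subr_gt0.
  rewrite -(pmulr_rge0 _ ac).
  have -> : (a - c) * ((a - c) * A ^+ 2 - (2 * a * t - e) * A + (a * t ^+ 2 - c)) =
    ((a - c) * A - (a * t - e / 2)) ^+ 2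
    + ((a * t * e - a * (c * (1 + t ^+ 2))) + c ^+ 2 - e ^+ 2 / 4) by field.
  rewrite cE addr_ge0 ?sqr_ge0 //.
  have : 0 <= e * (2 * a * t - e) by rewrite mulr_ge0 ?subr_ge0 // ltW.
  have := sqr_ge0 c; nra.
nra.
Qed.

(** At a critical point of |grad u|^2 u^(-g), the Laplacian of the logarithm of this
    quantity is at least z / u^2 times the form at A = f u / z. *)
Definition bernstein_form {R : realFieldType} (n p q g A : R) : R :=
  2 / n * A ^+ 2 + (2 * g / n + g * (1 - q) - 2 * p) * A
  + (g - g ^+ 2 * (n - 1) / (2 * n)).

(** The condition of [quadratic_coercive] with a t^2 = c0 reads
      p + q - 1 < p + 2 / n - 2 p y + 2 sqrt ((2 / n) (y - (n - 1) / (2 n)))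
    with y = 1 / g. For p > 0 the right-hand side is largest at
    y = (n - 1) / (2 n) + 1 / (2 n p^2), with value (p + 1)^2 / (p n). For p >= 1
    this g would be at least 2, and g = 2 gives the bound 4 / n. For p = 0 the
    right-hand side is unbounded as g tends to 0. *)
Lemma exists_coercive_exponent {R : realFieldType} (n p q : R) :
  1 <= n -> q < 2 -> 0 < p + q - 1 ->
  [\/ 1 <= p /\ p + q - 1 < 4 / n,
      0 < p < 1 /\ p + q - 1 < (p + 1) ^+ 2 / (p * n) | p = 0] ->
  exists g c : R, [/\ 0 < g, g <= 2, 0 < c &
    forall A, 0 <= A -> c * (1 + A ^+ 2) <= bernstein_form n p q g A].
Proof.
move=> n1 q2 s0 H; have n0 : 0 < n by exact: lt_le_trans n1.
have nn0 : n != 0 by rewrite gt_eqF.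
suff [g [t [g0 g2 t0 Bt ct]]] : exists g t : R, [/\ 0 < g, g <= 2, 0 < t,
    0 < (2 * g / n + g * (1 - q) - 2 * p) + 2 * (2 / n) * t &
    2 / n * t ^+ 2 <= g - g ^+ 2 * (n - 1) / (2 * n)].
  have a0 : 0 < 2 / n by rewrite divr_gt0.
  by have [c c0 cP] := quadratic_coercive a0 t0 Bt ct; exists g, c.
case: H => [[p1 s4]|[/andP[p0 p1] sp]|p0].
- exists 2, 1; split => //.
    have -> : 2 * 2 / n + 2 * (1 - q) - 2 * p + 2 * (2 / n) * 1 = 2 * (4 / n - (p + q - 1)) by field.
    by rewrite mulr_gt0 // subr_gt0.
  by rewrite le_eqVlt; apply/orP; left; apply/eqP; field.
- pose D := (n - 1) * p ^+ 2 + 1.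
  have D0 : 0 < D by rewrite ltr_wpDl // mulr_ge0 ?sqr_ge0 // subr_ge0.
  have Dn0 : D != 0 by rewrite gt_eqF.
  have pn0 : p != 0 by rewrite gt_eqF.
  have g0 : 0 < 2 * n * p ^+ 2 / D by rewrite divr_gt0 // !mulr_gt0 // exprn_gt0.
  exists (2 * n * p ^+ 2 / D), (n * p / D); split => //.
  + rewrite ler_pdivrMr // /D; nra.
  + by rewrite divr_gt0 // mulr_gt0.
  + have -> : 2 * (2 * n * p ^+ 2 / D) / n + 2 * n * p ^+ 2 / D * (1 - q) - 2 * p
        + 2 * (2 / n) * (n * p / D)
      = 2 * n * p ^+ 2 / D * ((p + 1) ^+ 2 / (p * n) - (p + q - 1)).
      by rewrite /D; field; rewrite -/D Dn0 nn0 pn0.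
    by rewrite mulr_gt0 // subr_gt0.
  + rewrite le_eqVlt; apply/orP; left; apply/eqP.
    by rewrite /D; field; rewrite -/D Dn0 nn0.
- have n10 : 0 < 1 + n by rewrite ltr_pwDl // ltW.
  have nn10 : 1 + n != 0 by rewrite gt_eqF.
  have g0 : 0 < (1 + n)^-1 by rewrite invr_gt0.
  exists (1 + n)^-1, ((1 + n)^-1 * n / 4); split => //.
  + by rewrite invf_ple ?posrE //; lra.
  + by rewrite divr_gt0 // mulr_gt0.
  + have -> : 2 * (1 + n)^-1 / n + (1 + n)^-1 * (1 - q) - 2 * p
        + 2 * (2 / n) * ((1 + n)^-1 * n / 4)
      = (1 + n)^-1 * (2 / n + (2 - q)) by rewrite p0; field; rewrite nn10 nn0.
    by rewrite mulr_gt0 // addr_gt0 ?divr_gt0 // subr_gt0.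
  + rewrite -subr_ge0.
    have -> : (1 + n)^-1 - (1 + n)^-1 ^+ 2 * (n - 1) / (2 * n)
        - 2 / n * ((1 + n)^-1 * n / 4) ^+ 2
      = (8 * n * (1 + n) - 4 * (n - 1) - n ^+ 2) / (8 * n * (1 + n) ^+ 2).
      by field; rewrite nn10 nn0.
    rewrite divr_ge0 // ?mulr_ge0 ?sqr_ge0 // ?ltW //; nra.
Qed.

(** Multiplied by u^2 / z, the inequality bounds [bernstein_form] at A = f u / z by
    terms of the form kap and d (1 + A), where kap = k u^2 / z and d^2 is at most a
    multiple of kap. Half of the coercivity of the form absorbs d (1 + A), which
    leaves 1 + A^2 <= C kap. *)
Lemma bernstein_absorption {R : realFieldType} (n p q g c m M : R) :
  0 < n -> 0 <= q -> 0 < g -> 0 < c ->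
  (forall A, 0 <= A -> c * (1 + A ^+ 2) <= bernstein_form n p q g A) ->
  0 <= M ->
  exists2 C : R, 0 < C & forall z u f k s s2 l, 0 < z -> 0 < u -> 0 <= f -> 0 < k ->
    s ^+ 2 <= s2 * z -> s2 <= 4 * m ^+ 2 * k -> l = (g * z / u + s) / 2 ->
    (2 * (l ^+ 2 + (f + l) ^+ 2 / n) - 2 * (f * (p * z / u + q / 2 * (g * z / u + s)))) / z
      - (g ^+ 2 * z / u ^+ 2 + 2 * g * s / u + s2) + g * (f / u + z / u ^+ 2) <= M * k ->
    z <= C * k * u ^+ 2 /\ f ^+ 2 <= C * k * z.
Proof.
move=> n0 q0 g0 c0 cP M0.
have nn0 : n != 0 by rewrite gt_eqF.
pose K := 2 * g + 2 * g / n + 4 / n + 2 * q.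
pose C := 2 * (M + 4 * m ^+ 2 + K ^+ 2 * m ^+ 2 / c) / c + 1.
have K0 : 0 < K.
  have h1 : 0 < 2 * g / n by rewrite divr_gt0 // mulr_gt0.
  have h2 : 0 < 4 / n by rewrite divr_gt0.
  by rewrite /K; lra.
have C1 : 0 < C.
  have h : 0 <= K ^+ 2 * m ^+ 2 / c by rewrite divr_ge0 ?(ltW c0) // mulr_ge0 ?sqr_ge0.
  have m2 := sqr_ge0 m.
  by rewrite /C ltr_wpDl // divr_ge0 ?(ltW c0) //; lra.
exists C => // z u f k s s2 l z0 u0 f0 k0 ss2 s2k lE ineq.
have zn0 : z != 0 by rewrite gt_eqF.
have un0 : u != 0 by rewrite gt_eqF.
pose A := f * u / z; pose d := s * u / (2 * z).
pose kap := k * u ^+ 2 / z; pose e := s2 * u ^+ 2 / z.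
have A0 : 0 <= A by rewrite divr_ge0 ?mulr_ge0 // ltW.
have kap0 : 0 < kap by rewrite divr_gt0 // mulr_gt0 // exprn_gt0.
have ek : e <= 4 * m ^+ 2 * kap.
  rewrite /e /kap; have -> : 4 * m ^+ 2 * (k * u ^+ 2 / z) = (4 * m ^+ 2 * k) * u ^+ 2 / z by ring.
  by rewrite ler_pM2r ?invr_gt0 // ler_pM2r ?exprn_gt0.
have dk : d ^+ 2 <= m ^+ 2 * kap.
  suff : 4 * d ^+ 2 <= e by lra.
  have -> : 4 * d ^+ 2 = s ^+ 2 * (u ^+ 2 / z ^+ 2) by rewrite /d; field.
  have -> : e = s2 * z * (u ^+ 2 / z ^+ 2) by rewrite /e; field.
  by rewrite ler_pM2r // divr_gt0 ?exprn_gt0.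
have main : bernstein_form n p q g A + 2 * (1 + n^-1) * d ^+ 2
    + d * ((4 / n - 2 * q) * A - 2 * g + 2 * g / n) <= (M + 4 * m ^+ 2) * kap.
  have : ((2 * (l ^+ 2 + (f + l) ^+ 2 / n) - 2 * (f * (p * z / u + q / 2 * (g * z / u + s)))) / z
      - (g ^+ 2 * z / u ^+ 2 + 2 * g * s / u + s2) + g * (f / u + z / u ^+ 2)) * (u ^+ 2 / z)
      <= M * k * (u ^+ 2 / z).
    by rewrite ler_pM2r // divr_gt0 // exprn_gt0.
  have -> : M * k * (u ^+ 2 / z) = M * kap by rewrite /kap; ring.
  have -> : ((2 * (l ^+ 2 + (f + l) ^+ 2 / n) - 2 * (f * (p * z / u + q / 2 * (g * z / u + s)))) / z
      - (g ^+ 2 * z / u ^+ 2 + 2 * g * s / u + s2) + g * (f / u + z / u ^+ 2)) * (u ^+ 2 / z) =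
      bernstein_form n p q g A + 2 * (1 + n^-1) * d ^+ 2
    + d * ((4 / n - 2 * q) * A - 2 * g + 2 * g / n) - e.
    by rewrite lE /bernstein_form /A /d /e; field; rewrite zn0 un0 nn0.
  lra.
have lin : - (c / 2 * (1 + A ^+ 2)) - K ^+ 2 * m ^+ 2 / c * kap <=
    d * ((4 / n - 2 * q) * A - 2 * g + 2 * g / n).
  set B := (4 / n - 2 * q) * A - 2 * g + 2 * g / n.
  have iv0 : 0 < n^-1 by rewrite invr_gt0.
  have BK : B ^+ 2 <= K ^+ 2 * (2 * (1 + A ^+ 2)).
    have : `|B| <= K * (1 + A).
      rewrite ler_norml /B /K.
      have := mulr_ge0 q0 A0; have := mulr_ge0 (ltW iv0) A0; have := mulr_ge0 (ltW iv0) (ltW g0).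
      have := mulr_ge0 (ltW g0) A0; have := mulr_ge0 (mulr_ge0 (ltW iv0) (ltW g0)) A0.
      by move=> *; apply/andP; split; nra.
    move=> BA; rewrite -[B ^+ 2]real_normK ?num_real //.
    apply: (@le_trans _ _ ((K * (1 + A)) ^+ 2)).
      by rewrite ler_pXn2r ?nnegrE // mulr_ge0 ?ltW // ltr_wpDr.
    rewrite exprMn ler_pM2l ?exprn_gt0 //.
    have := sqr_ge0 (A - 1); nra.
  have cd : K ^+ 2 * d ^+ 2 / c <= K ^+ 2 * m ^+ 2 / c * kap.
    have -> : K ^+ 2 * m ^+ 2 / c * kap = K ^+ 2 * (m ^+ 2 * kap) / c by ring.
    by rewrite ler_pM2r ?invr_gt0 // ler_pM2l // exprn_gt0.
  have Kn0 : K != 0 by rewrite gt_eqF.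
  have cn0 : c != 0 by rewrite gt_eqF.
  (* Young's inequality for d B, weighted so that B^2 costs at most c (1 + A^2) / 2 *)
  have sq : 0 <= (B * (c / (2 * K)) + K * d) ^+ 2 / c by rewrite divr_ge0 ?sqr_ge0 // ltW.
  have BK' : (B * (c / (2 * K))) ^+ 2 / c <= c / 2 * (1 + A ^+ 2).
    have -> : (B * (c / (2 * K))) ^+ 2 / c = B ^+ 2 * (c / (4 * K ^+ 2)) by field; rewrite Kn0 cn0.
    have -> : c / 2 * (1 + A ^+ 2) = K ^+ 2 * (2 * (1 + A ^+ 2)) * (c / (4 * K ^+ 2)) by field.
    by rewrite ler_pM2r // divr_gt0 // mulr_gt0 // exprn_gt0.
  have E : (B * (c / (2 * K)) + K * d) ^+ 2 / c =
      (B * (c / (2 * K))) ^+ 2 / c + d * B + K ^+ 2 * d ^+ 2 / c.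
    by field; rewrite Kn0 cn0.
  lra.
have concl : 1 + A ^+ 2 <= C * kap.
  have d2 : 0 <= 2 * (1 + n^-1) * d ^+ 2.
    have iv0 : 0 < n^-1 by rewrite invr_gt0.
    by apply: mulr_ge0; [lra|exact: sqr_ge0].
  have cA := cP A A0.
  have H : c / 2 * (1 + A ^+ 2) <= (M + 4 * m ^+ 2 + K ^+ 2 * m ^+ 2 / c) * kap by lra.
  have c20 : 0 < c / 2 by rewrite divr_gt0.
  rewrite -(ler_pM2l c20); apply: (le_trans H).
  have -> : c / 2 * (C * kap) = (M + 4 * m ^+ 2 + K ^+ 2 * m ^+ 2 / c) * kap + c / 2 * kap.
    by rewrite /C; field; rewrite gt_eqF.
  by rewrite lerDl mulr_ge0 ?ltW.
have AE : A ^+ 2 * z ^+ 2 = f ^+ 2 * u ^+ 2 by rewrite /A; field.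
have kE : C * kap * z = C * k * u ^+ 2 by rewrite /kap; field.
split.
  rewrite -kE -[leLHS]mul1r ler_pM2r //; apply: le_trans concl; rewrite lerDl; exact: sqr_ge0.
have u20 : 0 < u ^+ 2 by rewrite exprn_gt0.
rewrite -(ler_pM2r u20) -AE.
have -> : C * k * z * u ^+ 2 = C * kap * z ^+ 2 by rewrite /kap; field.
by rewrite ler_pM2r ?exprn_gt0 //; apply: le_trans concl; rewrite lerDr.
Qed.

(** Multiplied by 2 (p + q - 1), the left-hand side is the sum of the two given
    expressions with weights 2 (p + q - 1) - (q - 1) (2 - g) and 2 - g. The first
    weight is 2 p + g (q - 1), nonnegative for q >= 1, and a sum of nonnegative
    terms for q < 1. *)
Lemma log_interpolation {R : realFieldType} (p q g a b w : R) :
  0 <= p -> q < 2 -> 0 < p + q - 1 -> 0 < g -> g <= 2 ->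
  b - 2 * a <= w -> 2 * p * a + (q - 1) * b <= w ->
  b - g * a <= (1 + (2 - q) * (2 - g) / (2 * (p + q - 1))) * w.
Proof.
move=> p0 q2 s0 g0 g2 H1 H2.
have s20 : 0 < 2 * (p + q - 1) by rewrite mulr_gt0.
rewrite -(ler_pM2l s20).
have -> : 2 * (p + q - 1) * ((1 + (2 - q) * (2 - g) / (2 * (p + q - 1))) * w) =
  (2 * (p + q - 1) - (q - 1) * (2 - g)) * w + (2 - g) * w by field; rewrite gt_eqF.
have -> : 2 * (p + q - 1) * (b - g * a) =
  (2 * (p + q - 1) - (q - 1) * (2 - g)) * (b - 2 * a) + (2 - g) * (2 * p * a + (q - 1) * b) by ring.
apply: lerD; apply: ler_wpM2l => //; last by rewrite subr_ge0.
have [q1|q1] := leP 1 q; nra.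
Qed.

(** * Functions of class C2 *)

Section C2.
Context {R : realType} {N : nat}.
Implicit Types (u : 'rV[R]_N -> R) (x y c : 'rV[R]_N) (i j : 'I_N).

Definition gradsq u x : R := \sum_i partial i u x ^+ 2.

Lemma euclidean_norm_gradient u x : euclidean_norm (gradient u x) = Num.sqrt (gradsq u x).
Proof. by congr Num.sqrt; apply: eq_bigr => i _; rewrite mxE. Qed.

Lemma gradsq_ge0 u x : 0 <= gradsq u x.
Proof. by apply: sumr_ge0 => i _; exact: sqr_ge0. Qed.

Lemma is_derive_partial u x i : class_C1 u -> is_derive x (basis_vec i) u (partial i u x).
Proof. by move=> [_ /(_ i)[/(_ x) /derivableP]]. Qed.

Lemma continuous_partial u i : class_C1 u -> continuous (partial i u).
Proof. by move=> [_ /(_ i)[]]. Qed.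

Lemma partial_diffq_cvg u i x : class_C1 u ->
  (fun yh => diffq u (basis_vec i) yh.2 yh.1) @ filter_prod (nbhs x) (0 : R)^' --> partial i u x.
Proof.
move=> Cu; apply: diffq_cvg; last exact: continuous_partial.
by near=> y; exact: is_derive_partial.
Unshelve. all: by end_near. Qed.

(** Both sides are limits of the second-order difference quotient with steps h
    along i and t along j: let h tend to 0 first, then t. *)
Lemma partial_comm u i j x : class_C2 u -> partial j (partial i u) x = partial i (partial j u) x.
Proof.
move=> [C1u C2u]; set l := RHS.
apply/eqP; rewrite -subr_eq0 -normr_le0; apply/ler_addgt0Pr => e e0; rewrite add0r.
have /nbhs_ballP[r /= r0 rP] : nbhs x [set y | `|partial i (partial j u) y - l| <= e].
  exact: cvgr_distC_le _ _ (@continuous_partial _ i (C2u j) x) _ e0.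
have r20 : 0 < r / 2 by rewrite divr_gt0.
have Dt := is_derive_diffq_cvg (is_derive_partial x j (C2u i)).
apply: (cvgr_to_le (cvg_norm (cvgB Dt (cvg_cst l)))).
apply: filterS (near_small_scale (basis_vec j) r20) => t [t0 tP].
rewrite -[leLHS]/(`|diffq (partial i u) (basis_vec j) t x - l|).
have Dh : (diffq (diffq u (basis_vec i) h) (basis_vec j) t x) @[h --> (0 : R)^'] -->
    diffq (partial i u) (basis_vec j) t x.
  by apply: cvgMl_tmp; apply: cvgB; apply: is_derive_diffq_cvg; exact: is_derive_partial.
apply: (cvgr_to_le (cvg_norm (cvgB Dh (cvg_cst l)))).
apply: filterS (near_small_scale (basis_vec i) r20) => h [h0 hP].
rewrite -[leLHS]/(`|diffq (diffq u (basis_vec i) h) (basis_vec j) t x - l|).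
have [|s st ->] := @diffq_mvt _ _ (diffq u (basis_vec i) h)
  (diffq (partial j u) (basis_vec i) h) (basis_vec j) x t t0.
  by move=> s _; apply: is_derive_diffq => y; exact: is_derive_partial.
have [|s' sh ->] := @diffq_mvt _ _ (partial j u) (partial i (partial j u))
  (basis_vec i) (s *: basis_vec j + x) h h0.
  by move=> s' _; exact: is_derive_partial.
apply: rP; rewrite -ball_normE /= addrA opprD addrCA subrr addr0 normrN.
by rewrite (splitr r) (le_lt_trans (ler_normD _ _)) // ltrD // ?hP ?tP.
Qed.

End C2.

(** * Bernstein quantity of a positive solution *)

Section PositiveSolution.
Context {R : realType} {N : nat} (p q : R) (u : 'rV[R]_N -> R).
Context (solu : positive_solution p q u).
Implicit Types (x y c : 'rV[R]_N) (i j : 'I_N).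

Let C2u : class_C2 u. Proof. by have [] := solu. Qed.
Let C1u : class_C1 u. Proof. by have [] := C2u. Qed.
Let C1du i : class_C1 (partial i u). Proof. by have [_ ] := C2u. Qed.
Let upos x : 0 < u x. Proof. by have [_ ] := solu. Qed.
Let cu : continuous u. Proof. by have [] := C1u. Qed.

Definition gradsq1 j y : R := \sum_i 2 * (partial i u y * partial j (partial i u) y).

Definition laplacian1 i y : R :=
  laplacian u y * (p * (partial i u y / u y) + q / 2 * (gradsq1 i y / gradsq u y)).

Lemma is_derive_gradsq y j : is_derive y (basis_vec j) (gradsq u) (gradsq1 j y).
Proof.
apply: is_derive_sumE => i.
have := is_deriveX 2 (is_derive_partial y j (C1du i)).
by rewrite /= expr1 /GRing.scale /= -mulrA.
Qed.

Lemma continuous_gradsq : continuous (gradsq u).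
Proof.
move=> y; apply: (@cvg_sumr _ _ (nbhs y)) => i.
by apply: (cvgM (@continuous_partial _ _ u i C1u y) (@continuous_partial _ _ u i C1u y)).
Qed.

Lemma continuous_gradsq1 j : continuous (gradsq1 j).
Proof.
move=> y; apply: (@cvg_sumr _ _ (nbhs y)) => i; apply: cvgMl_tmp.
by apply: (cvgM (@continuous_partial _ _ u i C1u y) (@continuous_partial _ _ _ j (C1du i) y)).
Qed.

Lemma continuous_laplacian : continuous (laplacian u).
Proof.
move=> y; apply: (@cvg_sumr _ _ (nbhs y)) => i.
exact: (@continuous_partial _ _ _ i (C1du i) y).
Qed.

Lemma laplacianE y : 0 < gradsq u y ->
  laplacian u y = - expR (p * ln (u y) + q / 2 * ln (gradsq u y)).
Proof.
move=> z0; have [_ _ /(_ y) E] := solu.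
rewrite -[LHS]opprK E euclidean_norm_gradient; congr (- _).
rewrite -powR12_sqrt ?(ltW z0) // -powRrM /powR !gt_eqF //.
by rewrite expRD [_^-1 * q]mulrC.
Qed.

Lemma near_gradsq_gt0 y : 0 < gradsq u y -> \forall x \near y, 0 < gradsq u x.
Proof. by move=> z0; exact: cvgr_gt (@continuous_gradsq y) _ z0. Qed.

(** The equation makes Lap u differentiable, although u is only C^2: the right-hand
    side is a smooth function of u and of |grad u|^2 where the latter is positive. *)
Lemma is_derive_laplacian y i : 0 < gradsq u y ->
  is_derive y (basis_vec i) (laplacian u) (laplacian1 i y).
Proof.
move=> z0.
apply: (@near_eq_is_derive _ _ _ (fun y => - expR (p * ln (u y) + q / 2 * ln (gradsq u y)))).
  by apply: filterS (near_gradsq_gt0 z0) => x /laplacianE.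
have D1 := is_deriveZ p (is_derive_ln (upos y) (is_derive_partial y i C1u)).
have D2 := is_deriveZ (q / 2) (is_derive_ln z0 (is_derive_gradsq y i)).
have D3 := is_derive_comp1 (is_deriveD D1 D2) (is_derive_expR _).
have := is_deriveN D3; rewrite /laplacian1 laplacianE // mulNr.
by [].
Qed.

Lemma continuous_laplacian1 i y : 0 < gradsq u y -> {for y, continuous (laplacian1 i)}.
Proof.
move=> z0.
have un0 : u y != 0 by rewrite gt_eqF.
have zn0 : gradsq u y != 0 by rewrite gt_eqF.
have A : (fun x => p * (partial i u x / u x)) @ y --> p * (partial i u y / u y).
  apply: (cvgMl_tmp (FF := nbhs_filter y)); apply: (cvg_div (FF := nbhs_filter y) un0).
    exact: (@continuous_partial _ _ u i C1u y).
  exact: cu.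
have B : (fun x => q / 2 * (gradsq1 i x / gradsq u x)) @ y --> q / 2 * (gradsq1 i y / gradsq u y).
  apply: (cvgMl_tmp (FF := nbhs_filter y)); apply: (cvg_div (FF := nbhs_filter y) zn0).
     exact: (@continuous_gradsq1 i y).
  exact: continuous_gradsq.
exact: (cvgM (@continuous_laplacian y) (cvgD A B)).
Qed.

Section AtPoint.
Context (m g r : R) (c x0 : 'rV[R]_N).

Let Phi y := r - sqdist c y.

Let Phi1 j y := - (2 * (y ord0 j - c ord0 j)).

Definition log_bernstein y : R := m * ln (Phi y) + ln (gradsq u y) - g * ln (u y).

Context (Phi_gt0 : 0 < Phi x0) (z_gt0 : 0 < gradsq u x0)
  (Lmax : \forall y \near x0, log_bernstein y <= log_bernstein x0).

Let is_derive_Phi y j : is_derive y (basis_vec j) Phi (Phi1 j y).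
Proof.
have := is_deriveB (is_derive_cst r y (basis_vec j)) (is_derive_sqdist c y j).
by rewrite sub0r.
Qed.

Let is_derive_Phi1 y j : is_derive y (basis_vec j) (Phi1 j) (- 2).
Proof.
have := is_deriveN (is_deriveZ 2 (is_derive_coordB c y j j)).
by rewrite eqxx /GRing.scale /= mulr1.
Qed.

Let continuous_Phi : continuous Phi.
Proof.
by move=> y; apply: (cvgB (FF := nbhs_filter y) (cvg_cst r)); exact: continuous_sqdist.
Qed.

Let nearPhi : \forall y \near x0, 0 < Phi y.
Proof. exact: cvgr_gt (@continuous_Phi x0) _ Phi_gt0. Qed.

Lemma first_order_condition j :
  m * (Phi1 j x0 / Phi x0) + gradsq1 j x0 / gradsq u x0
  - g * (partial j u x0 / u x0) = 0.
Proof.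
pose L1 y := m * (Phi1 j y / Phi y) + gradsq1 j y / gradsq u y - g * (partial j u y / u y).
apply: (@derive0_at_local_max _ _ log_bernstein L1 x0 (basis_vec j) _ Lmax).
apply: filterS (filterI nearPhi (near_gradsq_gt0 z_gt0)) => y [ph z].
have D1 := is_deriveZ m (is_derive_ln ph (is_derive_Phi y j)).
have D2 := is_derive_ln z (is_derive_gradsq y j).
have D3 := is_deriveZ g (is_derive_ln (upos y) (is_derive_partial y j C1u)).
exact: (is_deriveB (is_deriveD D1 D2) D3).
Qed.

Let W h i y := diffq u (basis_vec i) h y.
Let W1 h i j y := diffq (partial j u) (basis_vec i) h y.
Let W2 h i j y := diffq (partial j (partial j u)) (basis_vec i) h y.
Let Z h y := \sum_i W h i y ^+ 2.
Let Z1 h j y := \sum_i 2 * (W h i y * W1 h i j y).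
Let Z2 h j y := \sum_i 2 * (W1 h i j y ^+ 2 + W h i y * W2 h i j y).

Let is_derive_W h i j y : is_derive y (basis_vec j) (W h i) (W1 h i j y).
Proof. by apply: is_derive_diffq => x; exact: is_derive_partial. Qed.

Let is_derive_W1 h i j y : is_derive y (basis_vec j) (W1 h i j) (W2 h i j y).
Proof. by apply: is_derive_diffq => x; exact: is_derive_partial. Qed.

Let is_derive_Z h j y : is_derive y (basis_vec j) (Z h) (Z1 h j y).
Proof.
apply: is_derive_sumE => i.
by have := is_deriveX 2 (is_derive_W h i j y); rewrite /= expr1 /GRing.scale /= -mulrA.
Qed.

Let is_derive_Z1 h j y : is_derive y (basis_vec j) (Z1 h j) (Z2 h j y).
Proof.
apply: is_derive_sumE => i.
have := is_deriveZ 2 (is_deriveM (is_derive_W h i j y) (is_derive_W1 h i j y)).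
by rewrite /GRing.scale /= addrC -expr2.
Qed.

Let cvg1 (f : 'rV[R]_N -> R) x : {for x, continuous f} ->
  (fun yh : 'rV[R]_N * R => f yh.1) @ filter_prod (nbhs x) (0 : R)^' --> f x.
Proof.
move=> cf; apply: (cvg_comp (@fst _ R) f); [exact: cvg_fst|exact: cf].
Qed.

Let cvgZ x : (fun yh : 'rV[R]_N * R => Z yh.2 yh.1) @ filter_prod (nbhs x) (0 : R)^' --> gradsq u x.
Proof. by apply: cvg_sumr => i; apply: cvg_sqr; exact: partial_diffq_cvg. Qed.

Let Z2_sum h y : \sum_j Z2 h j y =
  2 * (\sum_i \sum_j W1 h i j y ^+ 2) + 2 * \sum_i W h i y * diffq (laplacian u) (basis_vec i) h y.
Proof.
rewrite exchange_big /= !mulr_sumr -big_split /=; apply: eq_bigr => i _.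
rewrite -mulr_sumr -mulrDr; congr (2 * _).
rewrite big_split /= -mulr_sumr; congr (_ + _ * _).
by rewrite /W2 /diffq /laplacian -mulr_sumr sumrB.
Qed.

Let cvgZ2 : (fun yh : 'rV[R]_N * R => \sum_j Z2 yh.2 j yh.1) @ filter_prod (nbhs x0) (0 : R)^' -->
  2 * (\sum_i \sum_j partial j (partial i u) x0 ^+ 2)
  + 2 * \sum_i partial i u x0 * laplacian1 i x0.
Proof.
under eq_cvg => yh do rewrite Z2_sum.
apply: cvgD; apply: cvgMl_tmp; apply: cvg_sumr => i.
  apply: cvg_sumr => j; apply: cvg_sqr; rewrite partial_comm //.
  exact: partial_diffq_cvg.
apply: cvgM; first exact: partial_diffq_cvg.
apply: (diffq_cvg (g1 := laplacian1 i)); last exact: continuous_laplacian1.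
by apply: filterS (near_gradsq_gt0 z_gt0) => y; exact: is_derive_laplacian.
Qed.

(** [limit_max_principle] applies with z replaced by Z h, the sum of the squares of
    the difference quotients of u. In the sum of the second derivatives of Z h, the
    terms W2 h i j add up over j to the difference quotient of Lap u along i
    ([Z2_sum]), which converges by [is_derive_laplacian]. *)
Lemma second_order_condition :
  m * (\sum_j (- 2 / Phi x0 - (Phi1 j x0 / Phi x0) ^+ 2))
  + ((2 * (\sum_i \sum_j partial j (partial i u) x0 ^+ 2)
      + 2 * \sum_i partial i u x0 * laplacian1 i x0) / gradsq u x0
     - \sum_j (gradsq1 j x0 / gradsq u x0) ^+ 2)
  - g * (\sum_j (partial j (partial j u) x0 / u x0 - (partial j u x0 / u x0) ^+ 2)) <= 0.
Proof.
pose M h y := m * ln (Phi y) + ln (Z h y) - g * ln (u y).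
pose M1 h j y := m * (Phi1 j y / Phi y) + Z1 h j y / Z h y - g * (partial j u y / u y).
pose M2 h j y := m * (- 2 / Phi y - (Phi1 j y / Phi y) ^+ 2)
  + (Z2 h j y / Z h y - (Z1 h j y / Z h y) ^+ 2)
  - g * (partial j (partial j u) y / u y - (partial j u y / u y) ^+ 2).
apply: (@limit_max_principle R N R (0 : R)^' _ log_bernstein M M1 M2 x0 _ Lmax).
- apply: filterS (filterI nearPhi (near_gradsq_gt0 z_gt0)) => y [ph z].
  apply: cvg_log_combination => //; last by apply: cvg1; exact: cu.
  by apply: cvg1; exact: continuous_Phi.
- have nPhi : \forall yh \near filter_prod (nbhs x0) (0 : R)^', 0 < Phi yh.1.
    exact: cvgr_gt (cvg1 (@continuous_Phi x0)) _ Phi_gt0.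
  have nZ : \forall yh \near filter_prod (nbhs x0) (0 : R)^', 0 < Z yh.2 yh.1.
    exact: cvgr_gt (@cvgZ x0) _ z_gt0.
  apply: filterS (filterI nPhi nZ) => -[y h] /= [ph z]; split => [|j].
    apply: (cvg_log_combination (FF := nbhs_filter y)) => //; first exact: continuous_Phi.
      apply: (cvg_sumr (FF := nbhs_filter y)) => i; apply: (cvg_sqr (FF := nbhs_filter y)).
      exact: continuous_diffq.
    exact: cu.
  split.
    have D1 := is_deriveZ m (is_derive_ln ph (is_derive_Phi y j)).
    have D2 := is_derive_ln z (is_derive_Z h j y).
    have D3 := is_deriveZ g (is_derive_ln (upos y) (is_derive_partial y j C1u)).
    exact: (is_deriveB (is_deriveD D1 D2) D3).
  have D1 := is_deriveZ m (is_derive_ln_derive ph (is_derive_Phi y j) (is_derive_Phi1 y j)).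
  have D2 := is_derive_ln_derive z (is_derive_Z h j y) (is_derive_Z1 h j y).
  have D3 := is_deriveZ g (is_derive_ln_derive (upos y) (is_derive_partial y j C1u)
    (is_derive_partial y j (C1du j))).
  exact: (is_deriveB (is_deriveD D1 D2) D3).
- apply: cvg_sum_log_second_derivative => //.
  + by apply: cvg1; exact: continuous_Phi.
  + by apply: cvg1; exact: cu.
  + move=> j; apply: cvg1; apply: (cvgN (FF := nbhs_filter x0)).
    apply: (cvgMl_tmp (FF := nbhs_filter x0)).
    by apply: (cvgB (FF := nbhs_filter x0)); [exact: coord_continuous|exact: cvg_cst].
  + move=> j; rewrite /gradsq1.
    apply: cvg_sumr => i; apply: cvgMl_tmp; apply: cvgM; first exact: partial_diffq_cvg.
    by rewrite partial_comm //; exact: partial_diffq_cvg.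
  + by move=> j; apply: cvg1; exact: continuous_partial.
  + by move=> j; apply: cvg1; exact: continuous_partial.
Qed.

End AtPoint.

(** * Estimate at the maximum, and conclusion *)

(** The first-order condition is used through its scalar product with grad u and
    through its square; both involve the contribution e of the cut-off, bounded
    by 2 k sqrt r / (r - |x0 - c|^2). *)
Lemma estimate_at_max (n g k cc : R) : N%:R = n + 1 -> 0 < n ->
  0 <= q -> 0 < g -> 0 < k -> 0 < cc ->
  (forall A, 0 <= A -> cc * (1 + A ^+ 2) <= bernstein_form n p q g A) ->
  exists2 C : R, 0 < C & forall (r : R) c x0, 0 < r - sqdist c x0 -> 0 < gradsq u x0 ->
    (\forall y \near x0, log_bernstein k g r c y <= log_bernstein k g r c x0) ->
    gradsq u x0 <= C * (r / (r - sqdist c x0) ^+ 2) * u x0 ^+ 2 /\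
    laplacian u x0 ^+ 2 <= C * (r / (r - sqdist c x0) ^+ 2) * gradsq u x0.
Proof.
move=> Nn n0 q0 g0 k0 cc0 ccP.
have M0 : 0 <= k * (2 * N%:R + 4) by rewrite mulr_ge0 ?ltW // ltr_wpDl // mulr_ge0.
have [C C0 CP] := bernstein_absorption k n0 q0 g0 cc0 ccP M0.
exists C => // r c x0 ph0 z0 Lmax.
have FO := first_order_condition ph0 z0 Lmax.
have SO := second_order_condition ph0 z0 Lmax.
set ph := r - sqdist c x0 in ph0 FO SO *; set z := gradsq u x0 in z0 FO SO *.
pose a i := partial i u x0; pose H i j := partial j (partial i u) x0.
(* e is minus the logarithmic gradient of the cut-off *)
pose e j := 2 * k * (x0 ord0 j - c ord0 j) / ph.
pose s := \sum_j e j * a j; pose s2 := \sum_j e j ^+ 2.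
pose f := - laplacian u x0; pose l := (g * z / u x0 + s) / 2.
have un0 : u x0 != 0 by rewrite gt_eqF.
have zn0 : z != 0 by rewrite gt_eqF.
have phn0 : ph != 0 by rewrite gt_eqF.
have zE : z = \sum_i a i ^+ 2 by [].
have z1E j : gradsq1 j x0 / z = g * (a j / u x0) + e j.
  have := FO j; rewrite -/(a j) => E.
  have -> : e j = - (k * (- (2 * (x0 ord0 j - c ord0 j)) / ph)) by rewrite /e; ring.
  lra.
have z1a : \sum_j a j * (gradsq1 j x0 / z) = g * z / u x0 + s.
  rewrite zE -mulrA mulr_suml mulr_sumr -big_split /=; apply: eq_bigr => j _.
  by rewrite z1E; ring.
have z1z1 : \sum_j (gradsq1 j x0 / z) ^+ 2 = g ^+ 2 * z / u x0 ^+ 2 + 2 * g * s / u x0 + s2.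
  rewrite zE -!mulrA !mulr_suml !mulr_sumr -!big_split /=; apply: eq_bigr => j _.
  by rewrite z1E; field.
have sum_d : \sum_j (x0 ord0 j - c ord0 j) ^+ 2 = r - ph by rewrite /ph opprB addrC subrK.
have phr : ph <= r by rewrite /ph gerBl sqdist_ge0.
have r0 : 0 < r := lt_le_trans ph0 phr.
have ph2 : 0 < ph ^+ 2 by rewrite exprn_gt0.
have kap0 : 0 < r / ph ^+ 2 by rewrite divr_gt0.
have ss2 : s ^+ 2 <= s2 * z by exact: cauchy_schwarz_sum.
have s2le : s2 <= 4 * k ^+ 2 * (r / ph ^+ 2).
  have -> : s2 = 4 * k ^+ 2 * ((r - ph) / ph ^+ 2).
    rewrite -sum_d mulr_suml mulr_sumr; apply: eq_bigr => j _; rewrite /e; field.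
    by [].
  rewrite ler_pM2l ?mulr_gt0 ?exprn_gt0 // ler_pM2r ?invr_gt0 //.
  by rewrite gerBl ltW.
have f0 : 0 <= f.
  by rewrite /f; have [_ _ ->] := solu; rewrite mulr_ge0 // powR_ge0.
have lapf : laplacian u x0 = - f by rewrite /f opprK.
(* l is the Rayleigh quotient of the Hessian in the direction of grad u *)
have HT : l ^+ 2 + (f + l) ^+ 2 / n <= \sum_i \sum_j H i j ^+ 2.
  have -> : (f + l) ^+ 2 = (laplacian u x0 - l) ^+ 2 by rewrite /f; ring.
  apply: (hessian_trace_ineq Nn n0 zE z0) => //.
  rewrite exchange_big /=.
  have -> : z * l = z / 2 * \sum_j a j * (gradsq1 j x0 / z) by rewrite z1a /l; field.
  rewrite big_distrr /=; apply: eq_bigr => j _.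
  rewrite /gradsq1 -mulr_sumr -mulr_suml -/a.
  have -> : \sum_i a i * H i j = \sum_i partial i u x0 * partial j (partial i u) x0 by [].
  by field.
have aF : \sum_i a i * laplacian1 i x0 = - (f * (p * z / u x0 + q / 2 * (g * z / u x0 + s))).
  have -> : p * z / u x0 = \sum_i p * (a i ^+ 2 / u x0).
    by rewrite zE -mulr_sumr -mulr_suml mulrA.
  rewrite -z1a -mulNr -lapf mulr_sumr -big_split mulr_sumr /=; apply: eq_bigr => j _.
  by rewrite /laplacian1 -/(a j) -/z; ring.
have ulap : \sum_j (partial j (partial j u) x0 / u x0 - (partial j u x0 / u x0) ^+ 2) =
    - (f / u x0 + z / u x0 ^+ 2).
  rewrite opprD -mulNr -lapf zE !mulr_suml -sumrB; apply: eq_bigr => j _.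
  by rewrite -/(a j); field.
have phs : - (k * (2 * N%:R + 4) * (r / ph ^+ 2)) <=
    k * (\sum_j (- 2 / ph - (- (2 * (x0 ord0 j - c ord0 j)) / ph) ^+ 2)).
  have -> : \sum_j (- 2 / ph - (- (2 * (x0 ord0 j - c ord0 j)) / ph) ^+ 2) =
     - (2 * N%:R * (ph / ph ^+ 2) + 4 * ((r - ph) / ph ^+ 2)).
    rewrite sumrB sumr_const card_ord -mulr_natr opprD; congr (_ + _); first by field.
    congr (- _); rewrite -sum_d mulr_suml mulr_sumr; apply: eq_bigr => j _; field.
    by [].
  rewrite -mulrA -mulrN ler_pM2l // lerN2 [leRHS]mulrDl.
  have iv : 0 < (ph ^+ 2)^-1 by rewrite invr_gt0.
  apply: lerD.
    by rewrite ler_wpM2l ?mulr_ge0 // ler_pM2r.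
  by rewrite ler_wpM2l // ler_pM2r // gerBl ltW.
have iz : 0 < z^-1 by rewrite invr_gt0.
have [|H1 H2] := CP z (u x0) f (r / ph ^+ 2) s s2 l z0 (upos x0) f0 kap0 ss2 s2le erefl.
  move: SO; rewrite z1z1 ulap aF => SO.
  have HT' : 2 * (l ^+ 2 + (f + l) ^+ 2 / n) / z <= 2 * (\sum_i \sum_j H i j ^+ 2) / z.
    by rewrite ler_pM2r // ler_pM2l.
  move: SO phs HT'; rewrite !(mulrDl _ _ z^-1) mulrN.
  set S1 := \sum_i \sum_j _; set S2 := \sum_j _.
  set X := f * _; set l2 := l ^+ 2 + _.
  set k1 := g ^+ 2 * z / u x0 ^+ 2 + _ + _; set g1 := f / u x0 + _.
  lra.
by split => //; rewrite lapf sqrrN.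
Qed.

(** The exponential of the function extends continuously to the closed ball and
    vanishes where the gradient or the cut-off does. *)
Lemma exists_log_bernstein_max (k : nat) (g r : R) c : (0 < k)%N -> 0 < r -> 0 < gradsq u c ->
  exists x0, [/\ 0 < r - sqdist c x0, 0 < gradsq u x0,
    log_bernstein k%:R g r c c <= log_bernstein k%:R g r c x0 &
    \forall y \near x0, log_bernstein k%:R g r c y <= log_bernstein k%:R g r c x0].
Proof.
move=> k0 r0 zc.
pose psi y := (r - sqdist c y) ^+ k * gradsq u y * expR (- g * ln (u y)).
have cpsi : continuous psi.
  move=> y; have FF := nbhs_filter y.
  apply: (cvgM (FF := FF)); first apply: (cvgM (FF := FF)).
  - apply: (cvg_comp (fun y => r - sqdist c y) (fun t : R => t ^+ k)); last exact: exprn_continuous.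
    by apply: (cvgB (FF := FF) (cvg_cst r)); exact: continuous_sqdist.
  - exact: continuous_gradsq.
  apply: (cvg_comp (fun y => - g * ln (u y)) (@expR R)); last exact: continuous_expR.
  by apply: (cvgMl_tmp (FF := FF)); apply: cvg_ln => //; exact: cu.
have ln_psi y : 0 < r - sqdist c y -> 0 < gradsq u y ->
    0 < psi y /\ ln (psi y) = log_bernstein k%:R g r c y.
  move=> ph z; have ph' := exprn_gt0 k ph; have E := expR_gt0 (- g * ln (u y)).
  split; first by rewrite /psi !mulr_gt0.
  rewrite /psi !lnM ?posrE ?mulr_gt0 // expRK lnXn // /log_bernstein.
  by rewrite mulNr mulr_natl.
have [x0 x0r max] := exists_ball_max (c := c) r0 (fun y _ => cpsi y).
have c_in : 0 < r - sqdist c c by rewrite sqdist_xx subr0.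
have [psic lnc] := ln_psi c c_in zc.
have psi0 : 0 < psi x0 by apply: lt_le_trans psic (max c _); rewrite sqdist_xx ltW.
have ph0 : 0 < r - sqdist c x0.
  rewrite lt_def subr_ge0 x0r andbT; apply/eqP => E.
  by move: psi0; rewrite /psi E expr0n -[k == 0%N]negbK -lt0n k0 !mul0r ltxx.
have z0 : 0 < gradsq u x0.
  rewrite lt_def gradsq_ge0 andbT; apply/eqP => E.
  by move: psi0; rewrite /psi E mulr0 mul0r ltxx.
have [_ ln0] := ln_psi x0 ph0 z0.
have le0 y : 0 < r - sqdist c y -> 0 < gradsq u y ->
    log_bernstein k%:R g r c y <= log_bernstein k%:R g r c x0.
  move=> ph z; have [psiy lny] := ln_psi y ph z.
  by rewrite -lny -ln0 ler_ln ?posrE // max // -subr_ge0 ltW.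
exists x0; split => //; first exact: le0.
have near_ph : \forall y \near x0, 0 < r - sqdist c y.
  have cph : (fun y => r - sqdist c y) @ x0 --> r - sqdist c x0.
    by apply: (cvgB (FF := nbhs_filter x0) (cvg_cst r)); exact: continuous_sqdist.
  exact: cvgr_gt cph _ ph0.
by apply: filterS (filterI near_ph (near_gradsq_gt0 z0)) => y [? ?]; exact: le0.
Qed.

(** The bound at the maximum x0 blows up at the boundary of the ball like the power
    - 2 M of r - |x0 - c|^2; raising the latter to a power k >= 2 M in the cut-off
    compensates for this. *)
Lemma gradsq_eq0 (n g cc : R) : N%:R = n + 1 -> 0 < n ->
  0 <= p -> 0 <= q -> q < 2 -> 0 < p + q - 1 -> 0 < g -> g <= 2 -> 0 < cc ->
  (forall A, 0 <= A -> cc * (1 + A ^+ 2) <= bernstein_form n p q g A) ->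
  forall c, gradsq u c = 0.
Proof.
move=> Nn n0 p0 q0 q2 s0 g0 g2 cc0 ccP c; apply/eqP/negPn/negP => zcn0.
have zc : 0 < gradsq u c by rewrite lt_def zcn0 gradsq_ge0.
pose M := 1 + (2 - q) * (2 - g) / (2 * (p + q - 1)).
have M1 : 1 <= M.
  rewrite lerDl; apply: divr_ge0; apply: mulr_ge0; lra.
have M0 : 0 < M := lt_le_trans ltr01 M1.
pose k := Num.bound (2 * M).
have kM : 2 * M < k%:R.
  by apply: archi_boundP; rewrite mulr_ge0 // ltW.
have k0 : 0 < k%:R :> R by apply: lt_trans kM; rewrite mulr_gt0.
have [C C0 CP] := estimate_at_max Nn n0 q0 g0 k0 cc0 ccP.
pose b0 := ln (gradsq u c) - g * ln (u c).
(* the squared radius exp lr is chosen with M (ln C - lr) = b0 - 1 *)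
pose lr := ln C - (b0 - 1) / M.
have kn0 : (0 < k)%N by rewrite -(ltr0n R).
have [x0 [ph0 z0 le_c /(CP _ _ _ ph0 z0)[H1 H2]]] :=
  exists_log_bernstein_max g kn0 (expR_gt0 lr) zc.
move: le_c; rewrite /log_bernstein sqdist_xx subr0 expRK.
set r := expR lr in ph0 H1 H2 *; set ph := r - sqdist c x0 in ph0 H1 H2 *.
set b := ln (gradsq u x0); set a := ln (u x0) => le_c.
have r0 : 0 < r := expR_gt0 lr.
have lph : ln ph <= lr.
  by rewrite -[lr]expRK ler_ln ?posrE // /ph gerBl sqdist_ge0.
have lk : ln (C * (r / ph ^+ 2)) = ln C + lr - 2 * ln ph.
  rewrite lnM ?posrE ?divr_gt0 ?exprn_gt0 // ln_div ?posrE ?exprn_gt0 // expRK lnXn //.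
  by rewrite mulr_natl addrA.
have kp : 0 < C * (r / ph ^+ 2) by rewrite mulr_gt0 // divr_gt0 // exprn_gt0.
have I1 : b - 2 * a <= ln C + lr - 2 * ln ph.
  have L : ln (gradsq u x0) <= ln (C * (r / ph ^+ 2) * u x0 ^+ 2).
    by rewrite ler_ln ?posrE // mulr_gt0 // exprn_gt0.
  move: L; rewrite lnM ?posrE ?exprn_gt0 // lk lnXn // -/a -/b -mulr_natl; lra.
have I2 : 2 * p * a + (q - 1) * b <= ln C + lr - 2 * ln ph.
  move: H2; rewrite (laplacianE z0) sqrrN.
  set E := expR _ => H2; have E0 : 0 < E by exact: expR_gt0.
  have L : ln (E ^+ 2) <= ln (C * (r / ph ^+ 2) * gradsq u x0).
    by rewrite ler_ln // posrE; [exact: exprn_gt0|exact: mulr_gt0].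
  move: L; rewrite lnXn // expRK lnM ?posrE // lk -/a -/b -mulr_natl; lra.
have I3 := log_interpolation p0 q2 s0 g0 g2 I1 I2; rewrite -/M in I3.
have I4 : (k%:R - 2 * M) * ln ph <= (k%:R - 2 * M) * lr by rewrite ler_pM2l // subr_gt0.
have I5 : b0 <= M * (ln C - lr).
  by rewrite /b0; lra.
have : M * (ln C - lr) = b0 - 1 by rewrite /lr; field; rewrite gt_eqF.
move=> E; rewrite E in I5; lra.
Qed.

Lemma constant_of_gradsq_eq0 : (forall x, gradsq u x = 0) -> forall x, u x = u 0.
Proof.
move=> z0.
have d0 i x : partial i u x = 0.
  have sq0 j : true -> 0 <= partial j u x ^+ 2 by rewrite sqr_ge0.
  by apply/eqP; rewrite -sqrf_eq0 (psumr_eq0P sq0 (z0 x)).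
have inv i (t : R) x : u (t *: basis_vec i + x) = u x.
  rewrite -[in RHS](add0r x) -(scale0r (basis_vec i)).
  apply: (@is_derive_0_is_cst _ (fun s : R => u (s *: basis_vec i + x))) => s.
  by apply: is_derive_line; rewrite -(d0 i (s *: basis_vec i + x)); exact: is_derive_partial.
move=> x; rewrite [x in LHS]row_sum_delta.
elim: (index_enum _) => [|i s IH]; first by rewrite big_nil.
by rewrite big_cons inv.
Qed.

End PositiveSolution.

Theorem mainTheorem3 (R : realType) (N : nat) (p q : R)
  (hN : (2 <= N)%N) (hq : 0 <= q < 2) (hp : 0 <= p) (hpq : 0 < p + q - 1)
  (hcases :
    (1 <= p < (N%:R + 3) / (N%:R - 1) /\ p + q - 1 < 4 / (N%:R - 1))
    \/ (0 <= p < 1 /\ ((p + q - 1)%:E < bound_small_p N p)%E))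
  (u : 'rV[R]_N -> R) (hu : positive_solution p q u) :
  exists c : R, forall x : 'rV[R]_N, u x = c.
Proof.
have /andP[q0 q2] := hq.
have n1 : 1 <= N%:R - 1 :> R by rewrite lerBrDr -[1 + 1]/(2%:R) ler_nat.
have cases : [\/ 1 <= p /\ p + q - 1 < 4 / (N%:R - 1),
    0 < p < 1 /\ p + q - 1 < (p + 1) ^+ 2 / (p * (N%:R - 1)) | p = 0].
  case: hcases => [[/andP[p1 _] s4]|[/andP[_ p1]]]; first exact: Or31.
  rewrite /bound_small_p; have [-> _|pn0] := eqVneq p 0; first exact: Or33.
  by rewrite lte_fin => s4; apply: Or32; split => //; rewrite p1 andbT lt_def pn0.
have [g [c [g0 g2 c0 coercive]]] := exists_coercive_exponent n1 q2 hpq cases.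
exists (u 0); apply: (constant_of_gradsq_eq0 hu).
have Nn : N%:R = (N%:R - 1) + 1 :> R by rewrite subrK.
exact: (gradsq_eq0 hu Nn (lt_le_trans ltr01 n1) hp q0 q2 hpq g0 g2 c0 coercive).
Qed.
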